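(* Let $k\ge 1$ and $\alpha>0$ be fixed real constants. Suppose that the sequences of nonnegative integers $N(n)$ and $C(n)$ satisfy, as $n\to\infty$, $$N(n)=\alpha n^k+O(n^{k-1}),\qquad C(n)=\alpha n^k+O(n^{k-1}).$$ Then $$\frac{N(n)!}{N(n)^{\,C(n)}}\longrightarrow 0\qquad\text{as } n\to\infty.$$
   Context: Here $N(n)$ plays the role of the number of nodes and $C(n)$ the number of naive constraints (the number of required equal-sum conditions) of a combinatorial configuration of order $n$. *)

(* Defs.v *)
From mathcomp Require Export all_boot all_order all_algebra.
From mathcomp Require Export all_classical all_reals all_analysis.
Export numFieldNormedType.Exports.

(* Main.v *)
Require Import Defs.
From mathcomp Require Import lra ring.
Import Order.TTheory GRing.Theory Num.Theory.

Local Open Scope classical_set_scope.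
Local Open Scope ring_scope.

(** Only the exponential saving of N! over N^N matters.  Indeed
    N! <= 2 N^N / 2^N ([exp2_fact_le]), so that
    N! / N^C <= 2 exp ((N - C) ln N - N ln 2).
    The leading terms of N and C agree, hence N - C = O(n^(k-1)), while
    ln N = O(ln n) and N is of order n^k.  The quotient of |N - C| ln N by N is
    therefore O(ln n / n), which tends to 0, and eventually
    |N - C| ln N <= (ln 2 / 2) N ([near_gap_ln_le]).  What remains is at most
    2 exp (- (ln 2 / 2) N) ([fact_div_exp_le]); since k >= 1 makes N grow at
    least linearly ([near_linear_le]), a geometric sequence of ratio less
    than 1 dominates it. *)

(** Bernoulli's inequality (1 + 1/n)^n >= 2, cleared of denominators: the two
    terms of highest degree in n of the binomial expansion both equal n^n. *)
Lemma double_expn_le n : (0 < n)%N -> (2 * n ^ n <= n.+1 ^ n)%N.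
Proof.
case: n => // n _.
rewrite -[X in (_ <= X ^ _)%N]addn1 expnDn !big_ord_recl /=.
rewrite /bump /= bin0 bin1 !exp1n subn0 addn0 subn1 !muln1 mul1n -expnS.
by rewrite addnA mul2n -addnn leq_addr.
Qed.

(** A crude form of Stirling's bound, with 2 in place of e: the ratio of
    consecutive values of n^n / n! is (1 + 1/n)^n, which is at least 2.  Any
    base greater than 1 would serve for the limit. *)
Lemma exp2_fact_le n : (0 < n)%N -> (2 ^ n * n`! <= 2 * n ^ n)%N.
Proof.
case: n => // n _; elim: n => [//|n IHn].
rewrite expnS factS mulnACA.
apply: (@leq_trans (2 * n.+2 * (2 * n.+1 ^ n.+1))).
  by rewrite leq_mul2l IHn orbT.
by rewrite (expnS n.+2) -mulnA !leq_mul2l double_expn_le //= ?orbT.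
Qed.

(** The estimate of the factorial leaves exp (- N ln 2) times N^(N - C); the
    hypothesis lets the second factor, of either sign of N - C, consume only
    half of that decay. *)
Lemma fact_div_exp_le {R : realType} {N C : nat} : (0 < N)%N ->
  `|N%:R - C%:R| * ln N%:R <= ln 2 / 2 * N%:R :> R ->
  N`!%:R / N%:R ^+ C <= 2 * expR (- (ln 2 / 2 * N%:R)) :> R.
Proof.
move=> N0 gap.
have NR0 : 0 < N%:R :> R by rewrite ltr0n.
have N1 : 0 <= ln N%:R :> R by rewrite ln_ge0// ler1n.
have expE (x : R) m : 0 < x -> x ^+ m = expR (m%:R * ln x).
  by move=> x0; rewrite expRM_natl lnK.
have factle : N`!%:R <= 2 * expR (N%:R * ln N%:R - N%:R * ln 2) :> R.
  rewrite expRB -!expE// mulrA ler_pdivlMr ?exprn_gt0//.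
  by rewrite -!natrX -!natrM ler_nat mulnC exp2_fact_le.
rewrite (expE _ C)// ler_pdivrMr ?expR_gt0//; apply: (le_trans factle).
rewrite -[leRHS]mulrA -expRD ler_pM2l// ler_expR.
have := ler_wpM2r N1 (ler_norm (N%:R - C%:R : R)).
by move: gap; rewrite mulrBl; lra.
Qed.

Lemma bigO_pos_bound {R : realType} {f g e : nat -> R} :
  f = g +O_\oo e ->
  exists2 K : R, 0 < K & \forall n \near \oo, `|f n - g n| <= K * `|e n|.
Proof.
move=> /eqaddOP H.
near (pinfty_nbhs R) => K; exists K; last by near: K.
by near: K; apply: nbhs_pinfty_gt.
Unshelve. all: by end_near. Qed.

(** The square root stands for any power of exponent less than 1: all that
    counts is that the bound is sublinear and explicit.  It comes from
    ln y < y at y = sqrt x. *)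
Lemma ln_le_sqrt {R : realType} {x : R} : 0 < x -> ln x <= 2 * Num.sqrt x.
Proof.
move=> x0; have s0 : 0 < Num.sqrt x by rewrite sqrtr_gt0.
rewrite -{1}(sqr_sqrtr (ltW x0)) lnXn//.
by rewrite -[leLHS]mulr_natl ler_pM2l// ltW// ln_sublinear.
Qed.

Definition leading_term {R : realType} (k alpha : R) (f : nat -> nat) :=
  (fun n : nat => (f n)%:R : R) =
  (fun n : nat => alpha * (n%:R : R) `^ k)
    +O_\oo (fun n : nat => (n%:R : R) `^ (k - 1)).

Lemma powR_subr1_mul {R : realType} (k : R) (n : nat) : (0 < n)%N ->
  (n%:R : R) `^ k = n%:R `^ (k - 1) * n%:R.
Proof.
move=> n0; have nR0 : n%:R != 0 :> R by rewrite pnatr_eq0 -lt0n.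
rewrite -[X in _ = _ * X](powRr1 (ler0n R n)) -powRD ?subrK//.
by rewrite nR0 implybT.
Qed.

(** The error term loses a factor n against the leading one, so it ends up below
    half of it.  The power n^k appears as n^(k-1) n so as to be compared with
    error terms. *)
Lemma near_two_sided {R : realType} {k alpha : R} {N : nat -> nat} :
  0 < alpha -> leading_term k alpha N ->
  \forall n \near \oo,
  alpha / 2 * (n%:R `^ (k - 1) * n%:R) <= (N n)%:R :> R /\
  (N n)%:R <= 2 * alpha * (n%:R `^ (k - 1) * n%:R) :> R.
Proof.
move=> alpha_gt0 hN; have [K K0 HK] := bigO_pos_bound hN.
near=> n.
have n0 : (0 < n)%N by near: n; exact: nbhs_infty_gt.
have q0 : 0 < n%:R `^ (k - 1) :> R by rewrite powR_gt0// ltr0n.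
have : `|(N n)%:R - alpha * n%:R `^ k| <= K * `|n%:R `^ (k - 1)| by near: n.
rewrite powR_subr1_mul// (gtr0_norm q0).
set q := _ `^ _ in q0 *.
have large : 2 * K / alpha <= n%:R by near: n; exact: nbhs_infty_ger.
have : K * q <= alpha / 2 * (q * n%:R).
  rewrite [leRHS](_ : _ = alpha / 2 * n%:R * q); last by ring.
  rewrite ler_pM2r//.
  by move: large; rewrite ler_pdivrMr//; lra.
have : 0 <= alpha * (q * n%:R) by rewrite !mulr_ge0// ltW.
by rewrite ler_norml => ? ? /andP[? ?]; split; lra.
Unshelve. all: by end_near. Qed.

Lemma near_linear_le {R : realType} {k alpha : R} {N : nat -> nat} :
  1 <= k -> 0 < alpha -> leading_term k alpha N ->
  \forall n \near \oo, alpha / 2 * n%:R <= (N n)%:R :> R.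
Proof.
move=> k1 alpha_gt0 hN; near=> n.
have n0 : (0 < n)%N by near: n; exact: nbhs_infty_gt.
have [+ _] : alpha / 2 * (n%:R `^ (k - 1) * n%:R) <= (N n)%:R :> R /\
  (N n)%:R <= 2 * alpha * (n%:R `^ (k - 1) * n%:R) :> R.
  by near: n; exact: near_two_sided alpha_gt0 hN.
apply: le_trans; rewrite ler_pM2l ?divr_gt0// ler_peMl//.
by rewrite -[leLHS](powRr0 n%:R) ler_powR ?ler1n// subr_ge0.
Unshelve. all: by end_near. Qed.

(** Dividing through by n^(k-1), the claim becomes a bound on a constant times
    ln N by a constant times n, and ln N is O(sqrt n): among the n
    large enough for these estimates, it holds once sqrt n exceeds the constant
    M of the proof. *)
Lemma near_gap_ln_le {R : realType} {k alpha c : R} {N C : nat -> nat} :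
  1 <= k -> 0 < alpha -> 0 < c ->
  leading_term k alpha N -> leading_term k alpha C ->
  \forall n \near \oo, `|(N n)%:R - (C n)%:R| * ln (N n)%:R <= c * (N n)%:R.
Proof.
move=> k1 alpha_gt0 c0 hN hC.
have [K1 K10 HK1] := bigO_pos_bound hN.
have [K2 K20 HK2] := bigO_pos_bound hC.
have hlin := near_linear_le k1 alpha_gt0 hN.
(* K1 + K2 bounds |N - C| / n^(k-1), 2 alpha + 2 k bounds ln N / sqrt n and
   alpha / 2 is a lower bound for N / n^k. *)
pose M := (K1 + K2) * (2 * alpha + 2 * k) / (c * (alpha / 2)).
near=> n.
have n0 : (0 < n)%N by near: n; exact: nbhs_infty_gt.
have nR0 : 0 < n%:R :> R by rewrite ltr0n.
have q0 : 0 < n%:R `^ (k - 1) :> R by rewrite powR_gt0.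
have [Nge Nle] : alpha / 2 * (n%:R `^ (k - 1) * n%:R) <= (N n)%:R :> R /\
  (N n)%:R <= 2 * alpha * (n%:R `^ (k - 1) * n%:R) :> R.
  by near: n; exact: near_two_sided alpha_gt0 hN.
have N1 : 1 <= (N n)%:R :> R.
  apply: (@le_trans _ _ (alpha / 2 * n%:R)); last by near: n.
  rewrite -ler_pdivrMl ?divr_gt0// mulr1.
  by near: n; exact: nbhs_infty_ger.
have dN : `|(N n)%:R - alpha * n%:R `^ k| <= K1 * `|n%:R `^ (k - 1)| by near: n.
have dC : `|(C n)%:R - alpha * n%:R `^ k| <= K2 * `|n%:R `^ (k - 1)| by near: n.
have s1 : 1 <= Num.sqrt n%:R :> R by rewrite -[leLHS]sqrtr1 ler_wsqrtr// ler1n.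
have sM : M <= Num.sqrt n%:R :> R.
  apply: (le_trans (ler_norm M)); rewrite -sqrtr_sqr ler_wsqrtr//.
  by near: n; exact: nbhs_infty_ger.
have lnN : ln (N n)%:R <= (2 * alpha + 2 * k) * Num.sqrt n%:R :> R.
  have a2 : 0 < 2 * alpha by rewrite mulr_gt0.
  apply: (@le_trans _ _ (ln (2 * alpha * n%:R `^ k))).
    rewrite ler_ln ?posrE ?(mulr_gt0 a2) ?powR_gt0//; first by rewrite powR_subr1_mul.
    exact: lt_le_trans N1.
  rewrite lnM ?posrE ?powR_gt0// ln_powR [leRHS]mulrDl lerD//.
    apply: (le_trans (ltW (ln_sublinear a2))).
    by rewrite ler_peMr// ltW.
  rewrite mulrAC [_ * k]mulrC ler_wpM2l// ?ln_le_sqrt//.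
  exact: le_trans k1.
have gap : `|(N n)%:R - (C n)%:R| <= (K1 + K2) * n%:R `^ (k - 1) :> R.
  apply: (le_trans (ler_distD (alpha * n%:R `^ k) _ _)).
  rewrite mulrDl -(gtr0_norm q0) lerD//.
  by rewrite distrC.
apply: (@le_trans _ _ (((K1 + K2) * n%:R `^ (k - 1)) *
    ((2 * alpha + 2 * k) * Num.sqrt n%:R))).
  by rewrite ler_pM// ln_ge0.
apply: (@le_trans _ _ (c * (alpha / 2 * (n%:R `^ (k - 1) * n%:R)))); last first.
  by rewrite ler_pM2l.
move: sM; rewrite /M ler_pdivrMr ?mulr_gt0 ?divr_gt0// => sM.
have qs0 : 0 < n%:R `^ (k - 1) * Num.sqrt n%:R :> R.
  by rewrite mulr_gt0// (lt_le_trans ltr01).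
rewrite -[X in _ <= c * (_ * (_ * X))](sqr_sqrtr (ltW nR0)).
move: sM; rewrite -(ler_pM2r qs0).
by congr (_ <= _); ring.
Unshelve. all: by end_near. Qed.

Theorem proposition5p1 (R : realType) (k alpha : R) (N C : nat -> nat)
    (k_ge1 : 1 <= k) (alpha_gt0 : 0 < alpha)
    (hN : (fun n : nat => (N n)%:R : R) =
          (fun n : nat => alpha * (n%:R : R) `^ k)
            +O_\oo (fun n : nat => (n%:R : R) `^ (k - 1)))
    (hC : (fun n : nat => (C n)%:R : R) =
          (fun n : nat => alpha * (n%:R : R) `^ k)
            +O_\oo (fun n : nat => (n%:R : R) `^ (k - 1))) :
  (fun n : nat => ((N n)`!)%:R / ((N n)%:R : R) ^+ C n : R) @ \oo --> (0 : R).
Proof.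
have c0 : 0 < ln 2 / 2 :> R by rewrite divr_gt0// ln_gt0// ltr1n.
pose z : R := expR (- (ln 2 / 2 * (alpha / 2))).
have hlin := near_linear_le k_ge1 alpha_gt0 hN.
have hgap := near_gap_ln_le k_ge1 alpha_gt0 c0 hN hC.
apply: (@squeeze_cvgr _ _ _ _ (fun=> 0) (geometric 2 z)); first last.
- apply: cvg_geometric; rewrite gtr0_norm ?expR_gt0// expR_lt1 oppr_lt0.
  by rewrite mulr_gt0// divr_gt0.
- exact: cvg_cst.
near=> n.
have n0 : (0 < n)%N by near: n; exact: nbhs_infty_gt.
have Nlin : alpha / 2 * n%:R <= (N n)%:R :> R by near: n.
have N0 : (0 < N n)%N.
  by rewrite -(ltr0n R) (lt_le_trans _ Nlin)// mulr_gt0 ?divr_gt0// ltr0n.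
rewrite divr_ge0 ?exprn_ge0//=.
apply: (le_trans (fact_div_exp_le N0 _)); first by near: n.
rewrite ler_pM2l// -expRM_natl ler_expR mulrN lerN2.
rewrite mulrCA ler_pM2l//.
by rewrite mulrC.
Unshelve. all: by end_near. Qed.
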